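(* Let $d\geq1$ be an integer, $\frac{d}{d+2}<q<1$, and set $m=\frac{2}{1-q}-d$ (so that $-\frac{m+d}{2}=\frac{1}{q-1}$ and $m>2$). For $a_1,\dots,a_d>0$ define on $\mathbb{Z}^d$ $$p_{k_1,\dots,k_d}=f_{m,d}(a_1,\dots,a_d)^{-1}\Big(1+\sum_{i=1}^d\frac{k_i^2}{a_i^2}\Big)^{-\frac{m+d}{2}},\qquad f_{m,d}(a_1,\dots,a_d)=\sum_{(k_1,\dots,k_d)\in\mathbb{Z}^d}\Big(1+\sum_{i=1}^d\frac{k_i^2}{a_i^2}\Big)^{-\frac{m+d}{2}}.$$ Let $u_i^2=\sum_{k\in\mathbb{Z}^d}k_i^2p_k$, $i=1,\dots,d$. Then (a) $p$ maximizes the $d$-variate Tsallis entropy $H_q(p)=\frac{1}{q-1}\big(1-\sum_{k\in\mathbb{Z}^d}p_k^q\big)$ among all probability distributions on $\mathbb{Z}^d$ with $\sum_kk_ip_k=0$ and $\sum_kk_i^2p_k=u_i^2$ for all $i$; and (b) as $\min_ia_i\to\infty$, $$\frac{f_{m,d}(a_1,\dots,a_d)}{\prod_{i=1}^da_i}\to\frac{\pi^{d/2}\,\Gamma(\frac m2)}{\Gamma(\frac{m+d}{2})}.$$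
   Context: $\Gamma$ is the Euler Gamma function. *)

(* Defs.v *)
From HB Require Import structures.
From mathcomp Require Import all_boot all_order all_algebra.
From mathcomp Require Import all_classical all_reals all_analysis.
Set Implicit Arguments. Unset Strict Implicit. Unset Printing Implicit Defensive.
Import Order.TTheory GRing.Theory Num.Theory.
Local Open Scope classical_set_scope.
Local Open Scope ring_scope.

Definition Zd (d : nat) := {ffun 'I_d -> int}.

Section defs.
Variable R : realType.

Definition abs_summable (T : choiceType) (f : T -> R) : Prop :=
  (\esum_(k in [set: T]) (`|f k|)%:E < +oo)%E.

(* Value of the series (meaningful when absolutely summable):
   sum of the positive part minus sum of the negative part. *)
Definition series_sum (T : choiceType) (f : T -> R) : R :=
  fine (\esum_(k in [set: T]) (Num.max (f k) 0)%:E)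
  - fine (\esum_(k in [set: T]) (Num.max (- f k) 0)%:E).

Definition sums_to (T : choiceType) (f : T -> R) (l : R) : Prop :=
  abs_summable f /\ series_sum f = l.

Definition prob_distr (d : nat) (p : Zd d -> R) : Prop :=
  (forall k, 0 <= p k) /\ sums_to p 1.

(* d-variate Tsallis entropy H_q(p) = (1 - sum_k p_k^q)/(q-1), extended-real valued
   (the sum of nonnegative terms may be +oo). *)
Definition tsallis (d : nat) (q : R) (p : Zd d -> R) : \bar R :=
  ((q - 1)^-1)%:E * (1%:E - \esum_(k in [set: Zd d]) (p k `^ q)%:E)%E.

Definition weight (d : nat) (m : R) (a : 'I_d -> R) (k : Zd d) : R :=
  (1 + \sum_(i < d) ((k i)%:~R ^+ 2 / a i ^+ 2)) `^ (- ((m + d%:R) / 2)).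

Definition fmd (d : nat) (m : R) (a : 'I_d -> R) : R :=
  fine (\esum_(k in [set: Zd d]) (weight m a k)%:E).

Definition pdist (d : nat) (m : R) (a : 'I_d -> R) (k : Zd d) : R :=
  (fmd m a)^-1 * weight m a k.

Definition Gamma (s : R) : R :=
  fine (\int[@lebesgue_measure R]_(t in `]0%R, +oo[) (t `^ (s - 1) * expR (- t))%:E)%E.

End defs.

(* Main.v *)
Require Import Defs.
From HB Require Import structures.
From mathcomp Require Import all_boot all_order all_algebra.
From mathcomp Require Import all_classical all_reals all_analysis.
From mathcomp Require Import measurable_realfun ring lra.
Import Order.TTheory GRing.Theory Num.Theory.
Import numFieldNormedType.Exports.
Local Open Scope classical_set_scope.
Local Open Scope ring_scope.

(* Part (a): the tangent inequality x^q <= y^q + q y^(q-1) (x - y), applied at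
   y = p_k and summed over k, reduces maximality to the equality of the two
   pairings of p^(q-1) with p and p'.  They agree because p_k^(q-1) is a constant
   times 1 + sum_i k_i^2/a_i^2, so the pairings only involve the total mass and
   the second moments.

   Part (b): with s = (m+d)/2, writing (1 + |x|^2)^(-s) Gamma(s) as the integral
   of t^(s-1) exp(-t) exp(-t|x|^2) over t > 0 and summing over the lattice gives
     Gamma(s) f_{m,d}(a) = int_0^oo t^(s-1) exp(-t) prod_i theta(t/a_i^2) dt,
   theta(u) = sum_{k in Z} exp(-u k^2).  The integral test gives
   |theta(u) - sqrt(pi/u)| <= 1, so theta(t/a_i^2)/a_i is within 1/a_i of
   sqrt(pi/t), and replacing each factor by sqrt(pi/t) leaves
   pi^(d/2) Gamma(s - d/2) with an error O(1/min_i a_i).  The same bound shows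
   that all the series involved converge; second moments are handled by
   replacing m with m - 2 > 0. *)

(** * Nonnegative sums over countable index types *)

Section countable_sums.
Local Open Scope ereal_scope.
Context {R : realType}.

(** Enumerates [T] through its pickling; integers that code no element contribute 0. This makes the
    convergence theorems for series available for sums over Z^d. *)
Lemma esum_countable (T : countType) (a : T -> \bar R) : (forall k, 0 <= a k) ->
  \esum_(k in [set: T]) a k = \sum_(n <oo) oapp a 0 (pickle_inv n).
Proof.
move=> a0; rewrite nneseries_esumT; last by move=> n; case: pickle_inv => /=.
rewrite (esumID (range (@pickle T))); last by move=> n _; case: pickle_inv => /=.
rewrite setTI [X in _ + X]esum1 ?adde0; last first.
  move=> n [_ nT]; case E : pickle_inv => [k|//]; exfalso; apply: nT.
  by exists k => //; have := @pickle_invK T n; rewrite /ocancel E.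
rewrite esum_image; last by move=> x y _ _; exact: pcan_inj pickleK_inv _ _.
by apply: eq_esum => k _; rewrite pickleK_inv.
Qed.

Lemma ge0_esumZl (T : countType) (a : T -> \bar R) (x : R) : (0 <= x)%R ->
  (forall k, 0 <= a k) ->
  \esum_(k in [set: T]) (x%:E * a k) = x%:E * \esum_(k in [set: T]) a k.
Proof.
move=> x0 a0; rewrite !esum_countable//; last by move=> k; rewrite mule_ge0.
rewrite -nneseriesZl; last by move=> n _; case: pickle_inv => /=.
by apply: eq_eseriesr => n _; case: pickle_inv => //=; rewrite mule0.
Qed.

(** Monotone convergence for the enumerated series. It serves to exchange the lattice sum with the
    integral over t. *)
Lemma ge0_integral_esum d (X : measurableType d) (mu : {measure set X -> \bar R})
    (D : set X) (T : countType) (f : T -> X -> \bar R) :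
  measurable D -> (forall k, measurable_fun D (f k)) ->
  (forall k x, D x -> 0 <= f k x) ->
  \int[mu]_(x in D) (\esum_(k in [set: T]) f k x) =
  \esum_(k in [set: T]) \int[mu]_(x in D) f k x.
Proof.
move=> mD mf f0.
rewrite esum_countable; last by move=> k; apply: integral_ge0 => x; exact: f0.
transitivity (\int[mu]_(x in D) \sum_(n <oo) oapp f (cst 0) (pickle_inv n) x).
  apply: eq_integral => x /[!inE] Dx; rewrite esum_countable; last by move=> k; exact: f0.
  by apply: eq_eseriesr => n _; case: pickle_inv.
rewrite integral_nneseries//.
- apply: eq_eseriesr => n _; case: pickle_inv => //=.
  by rewrite integral0.
- by move=> n; case: pickle_inv => //=; exact: measurable_cst.
- by move=> n x Dx; case: pickle_inv => //= k; exact: f0.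
Qed.

Lemma measurable_fun_esum d (X : measurableType d) (D : set X)
    (T : countType) (f : T -> X -> \bar R) :
  measurable D -> (forall k, measurable_fun D (f k)) ->
  (forall k x, D x -> 0 <= f k x) ->
  measurable_fun D (fun x => \esum_(k in [set: T]) f k x).
Proof.
move=> mD mf f0.
apply: (eq_measurable_fun (fun x => \sum_(n <oo | true) oapp f (cst 0) (pickle_inv n) x)).
  move=> x /[!inE] Dx; rewrite esum_countable; last by move=> k; exact: f0.
  by apply: eq_eseriesr => n _; case: pickle_inv.
apply: ge0_emeasurable_sum => //.
- by move=> n x Dx _; case: pickle_inv => //= k; exact: f0.
- by move=> n _; case: pickle_inv => //=; exact: measurable_cst.
Qed.

(** Tonelli for sums, by induction on the dimension: coordinate 0 is split off and summed separately
    from the others. It factors a lattice sum of Gaussians into theta values. *)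
Lemma esum_prod_ffun (T : countType) (d : nat) (g : 'I_d -> T -> R) (S : 'I_d -> R) :
  (forall i j, (0 <= g i j)%R) ->
  (forall i, \esum_(j in [set: T]) (g i j)%:E = (S i)%:E) ->
  \esum_(k in [set: {ffun 'I_d -> T}]) (\prod_(i < d) g i (k i))%:E =
  (\prod_(i < d) S i)%:E.
Proof.
elim: d g S => [|d IHd] g S g0 gS.
  (* In dimension 0 there is exactly one lattice point, the empty function, and the empty product is
     1. *)
  have -> : [set: {ffun 'I_0 -> T}] =
      [set [ffun i : 'I_0 => False_rect T (let: Ordinal _ h := i in notF h)]].
    by apply/seteqP; split => // k _; apply/ffunP => -[].
  by rewrite esum_set1 ?big_ord0// lee_fin.
(* Prepends a coordinate: [unlift ord0] is [None] exactly at index 0, where the default [jk.1] is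
   taken. *)
pose e (jk : T * {ffun 'I_d -> T}) : {ffun 'I_d.+1 -> T} :=
  [ffun i => oapp jk.2 jk.1 (unlift ord0 i)].
have eb : set_bij ([set: T] `*`` fun=> [set: {ffun 'I_d -> T}])
    [set: {ffun 'I_d.+1 -> T}] e.
  split => //.
  - move=> [j k] [j' k'] _ _ /ffunP E; congr pair.
      by have := E ord0; rewrite !ffunE unlift_none.
    by apply/ffunP => i; have := E (lift ord0 i); rewrite !ffunE liftK.
  - move=> k _; exists (k ord0, [ffun i => k (lift ord0 i)]) => //.
    apply/ffunP => i; rewrite !ffunE.
    by case: unliftP => [j|] -> //=; rewrite ffunE.
have p0 (k : {ffun 'I_d -> T}) : (0 <= \prod_(i < d) g (lift ord0 i) (k i))%R.
  exact: prodr_ge0.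
rewrite (reindex_esum _ _ _ _ eb).
transitivity (\esum_(jk in [set: T] `*`` fun=> [set: {ffun 'I_d -> T}])
    ((g ord0 jk.1)%:E * (\prod_(i < d) g (lift ord0 i) (jk.2 i))%:E)).
  apply: eq_esum => -[j k] _; rewrite big_ord_recl -EFinM/=; congr (_ * _)%:E.
    by rewrite ffunE unlift_none.
  by apply: eq_bigr => i _; rewrite ffunE liftK.
transitivity (\esum_(j in [set: T]) \esum_(k in [set: {ffun 'I_d -> T}])
    ((g ord0 j)%:E * (\prod_(i < d) g (lift ord0 i) (k i))%:E)).
  by rewrite esum_esum// => j k _ _; rewrite -EFinM lee_fin mulr_ge0.
transitivity (\esum_(j in [set: T]) ((\prod_(i < d) S (lift ord0 i))%:E * (g ord0 j)%:E)).
  apply: eq_esum => j _; rewrite ge0_esumZl//.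
  rewrite (IHd (fun i => g (lift ord0 i)) (fun i => S (lift ord0 i)))//.
  by rewrite muleC.
rewrite ge0_esumZl//.
- by rewrite gS -EFinM big_ord_recl mulrC.
- apply: prodr_ge0 => i _; rewrite -lee_fin -gS; apply: esum_ge0 => j _.
  by rewrite lee_fin.
- by move=> j; rewrite lee_fin.
Qed.

End countable_sums.

(** * The Gamma integral: finiteness, positivity, scaling *)

Section gamma.
Local Open Scope ereal_scope.
Context {R : realType}.
Notation mu := (@lebesgue_measure R).

(** The image of Lebesgue measure under x -> c x is 1/c times Lebesgue measure, by uniqueness of the
    measure that gives intervals their length. *)
Lemma ge0_integral_scale (c : R) (f : R -> R) : (0 < c)%R ->
  measurable_fun setT f -> (forall x, (0 <= f x)%R) ->
  \int[mu]_(x in `]0%R, +oo[) (f (c * x)%R)%:E =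
  (c^-1)%:E * \int[mu]_(x in `]0%R, +oo[) (f x)%:E.
Proof.
move=> c0 mf f0.
have ci0 : (0 <= c^-1)%R by rewrite invr_ge0 ltW.
pose phi : R -> measurableTypeR R := fun x => (c * x)%R.
have mphi : measurable_fun setT phi.
  by apply: measurable_funM => //; exact: measurable_cst.
have phiE b1 b2 (x y : R) : phi @^-1` [set` Interval (BSide b1 x) (BSide b2 y)] =
    [set` Interval (BSide b1 (x / c)%R) (BSide b2 (y / c)%R)].
  apply/seteqP; split => z /=; rewrite !in_itv/= /phi;
    by case: b1; case: b2; rewrite /= ?ler_pdivrMr ?ltr_pdivrMr
      ?ler_pdivlMr ?ltr_pdivlMr// (mulrC z).
have phi0 : phi @^-1` `]0%R, +oo[%classic = `]0%R, +oo[%classic.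
  by apply/seteqP; split => z /=; rewrite !in_itv/= /phi !andbT pmulr_rgt0.
transitivity (\int[pushforward mu phi]_(y in `]0%R, +oo[) (f y)%:E).
  rewrite ge0_integral_pushforward//= ?phi0//.
    by apply/measurable_EFinP; exact: measurable_funTS.
  by move=> y _; rewrite lee_fin.
pose k := NngNum ci0.
transitivity (\int[mscale k mu]_(y in `]0%R, +oo[) (f y)%:E).
  apply: eq_measure_integral => A mA _.
  suff : forall A, measurable A -> lebesgue_measure A =
      mscale (NngNum (ltW c0)) (pushforward mu phi) A.
    move=> /(_ mphi A mA) E; rewrite /mscale/= in E *.
    transitivity ((c^-1)%:E * mu A); last by [].
    by rewrite [X in _ = _ * X]E muleA -EFinM mulVf ?gt_eqF// mul1e.
  move=> mphi'; apply: lebesgue_measure_unique => _ [[a b] _ <-].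
  rewrite /mscale/= /pushforward/=.
  rewrite [X in _ = _ * lebesgue_measure X](phiE false false a b).
  rewrite !lebesgue_measure_itv/= !lte_fin.
  rewrite ltr_pM2r ?invr_gt0//; case: ifP => _; last by rewrite mule0.
  by rewrite -!EFinD -EFinM mulrBr !(mulrCA c) divff ?gt_eqF// !mulr1.
rewrite ge0_integral_mscale//.
  by apply/measurable_EFinP; exact: measurable_funTS.
by move=> y _; rewrite lee_fin.
Qed.

Definition gammafun (s t : R) : R := t `^ (s - 1) * expR (- t).

Lemma gammafun_ge0 s t : (0 <= gammafun s t)%R.
Proof. by rewrite mulr_ge0 ?powR_ge0 ?expR_ge0. Qed.

Lemma measurable_gammafun s : measurable_fun setT (gammafun s).
Proof.
apply: measurable_funM => //; apply: measurableT_comp => //.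
Qed.

Lemma continuous_powR (p x : R) : (0 < x)%R -> {for x, continuous (@powR R ^~ p)}.
Proof.
move=> x0; apply/differentiable_continuous/derivable1_diffP.
by apply: derivable_powR; rewrite in_itv/= x0.
Qed.

(** For s < 1 the integrand blows up at 0, so the fundamental theorem of calculus is applied on
    [1/(n+1), 1] with primitive t^s, and monotone convergence passes to the limit. *)
Lemma integral_powR_01 (s : R) : (0 < s)%R ->
  \int[mu]_(t in `]0%R, 1%R]) (s * t `^ (s - 1))%:E <= 1.
Proof.
move=> s0.
pose F (n : nat) := `[(n.+1%:R^-1 : R)%R, 1%R]%classic.
have -> : `]0%R, 1%R]%classic = \bigcup_n F n.
  apply/seteqP; split => x /=.
    rewrite in_itv/= => /andP[x0 x1].
    have xV0 : (0 <= x^-1)%R by rewrite invr_ge0 ltW.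
    exists (Num.bound x^-1) => //; rewrite /F/= in_itv/= x1 andbT.
    rewrite -[leRHS]invrK lef_pV2 ?posrE ?invr_gt0//.
    by rewrite (le_trans (ltW (archi_boundP xV0)))// ler_nat.
  by move=> [n _]; rewrite /F/= !in_itv/= => /andP[nx ->]; rewrite andbT (lt_le_trans _ nx).
have nF : nondecreasing_seq F.
  move=> m n mn; rewrite subsetEset => x; rewrite /F/= !in_itv/= => /andP[mx ->].
  by rewrite andbT (le_trans _ mx)// lef_pV2 ?posrE// ler_nat.
have mF n : measurable (F n) by exact: measurable_itv.
have mf n : measurable_fun (F n) (fun t : R => (s * t `^ (s - 1))%:E).
  apply/measurable_EFinP; apply: measurable_funTS.
  by apply: measurable_funM => //; exact: measurable_powR.
have f0 n t : F n t -> 0 <= (s * t `^ (s - 1))%:E.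
  by rewrite lee_fin mulr_ge0 ?powR_ge0// ltW.
have : \int[mu]_(t in F i) (s * t `^ (s - 1))%:E @[i --> \oo] -->
    \int[mu]_(t in \bigcup_i F i) (s * t `^ (s - 1))%:E.
  exact: ge0_nondecreasing_set_cvg_integral.
move=> /cvg_lim <- //.
apply: lime_le.
  apply: ereal_nondecreasing_is_cvgn.
  exact: ge0_nondecreasing_set_nondecreasing_integral.
(* For n = 0 the interval is the single point 1; the fundamental theorem needs distinct
   endpoints. *)
apply: nearW => -[|n].
  by rewrite /F invr1 set_itv1 integral_set1.
have F1 : (n.+2%:R^-1 < 1 :> R)%R by rewrite invf_lt1// ltr1n.
have n0 : (0 < n.+2%:R^-1 :> R)%R by [].
rewrite /F (@continuous_FTC2 _ _ (@powR R ^~ s))//.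
- by rewrite powR1 lee_fin lerBlDr lerDl powR_ge0.
- apply: continuous_in_subspaceT => x /[!inE]/=; rewrite in_itv/= => /andP[nx _].
  apply: cvgM; first exact: cvg_cst.
  by apply: continuous_powR; rewrite (lt_le_trans n0).
- split.
  + move=> x; rewrite in_itv/= => /andP[nx _].
    by apply: derivable_powR; rewrite in_itv/= (lt_trans n0).
  + by apply: cvg_at_right_filter; exact: continuous_powR.
  + by apply: cvg_at_left_filter; exact: continuous_powR.
- move=> x; rewrite in_itv/= => /andP[nx _].
  by rewrite powR_derive1// in_itv/= (lt_trans n0).
Qed.

(** One term of the exponential series suffices: with N > |p| an integer, t^p <= t^N for t >= 1, and
    (t/2)^N / N! <= exp(t/2). *)
Lemma powR_le_expR (p : R) : exists2 C : R, (0 <= C)%R &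
  forall t : R, (1 <= t -> t `^ p <= C * expR (t / 2))%R.
Proof.
pose n := (Num.bound `|p|)%R.
exists (n.+1`!%:R * 2 ^+ n.+1)%R => [//|t t1].
have t0 : (0 <= t)%R by rewrite (le_trans _ t1).
have t20 : (0 <= t / 2)%R by rewrite divr_ge0.
apply: (@le_trans _ _ (t ^+ n.+1)%R).
  rewrite -powR_mulrn// ler_powR// (le_trans (ler_norm _))//.
  by rewrite (le_trans (ltW (archi_boundP (normr_ge0 p))))// ler_nat.
have := expR_ge1Dxn n t20; rewrite expr_div_n => h.
have {}h : (t ^+ n.+1 / 2 ^+ n.+1 / n.+1`!%:R <= expR (t / 2))%R.
  by rewrite (le_trans _ h)// lerDr.
move: h; rewrite !ler_pdivrMr ?ltr0n ?fact_gt0 ?exprn_gt0// => h.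
by rewrite (le_trans h)// le_eqVlt; apply/orP; left; apply/eqP; ring.
Qed.

(** Split at 1. On ]0, 1] the exponential is at most 1, leaving t^(s-1). Beyond 1, t^(s-1) <= C
    exp(t/2) leaves C exp(-t/2), which is 2C times the exponential density of rate 1/2. *)
Lemma Gamma_lty (s : R) : (0 < s)%R ->
  \int[mu]_(t in `]0%R, +oo[) (gammafun s t)%:E < +oo.
Proof.
move=> s0.
have mg D : measurable_fun D (fun t : R => (gammafun s t)%:E).
  apply/measurable_EFinP; apply: measurable_funTS; exact: measurable_gammafun.
have [C C0 hC] := powR_le_expR (s - 1).
have -> : `]0%R, +oo[%classic = `]0%R, 1%R]%classic `|` `]1%R, +oo[%classic :> set R.
  apply/seteqP; split => x /=; rewrite !in_itv/= !andbT.
    by move=> x0; case: (leP x 1%R) => x1; [left; rewrite x0|right].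
  by move=> [/andP[]//|]; exact: lt_trans.
rewrite ge0_integral_setU//=; last 3 first.
  exact: mg.
  by move=> x _; rewrite lee_fin gammafun_ge0.
  apply/disj_setPS => x [/=]; rewrite !in_itv/= => /andP[_ x1] /andP[x2 _].
  by move: (lt_le_trans x2 x1); rewrite ltxx.
have h0 : (0 < 2^-1 :> R)%R by [].
have mf D : measurable_fun D (fun t : R => (s * t `^ (s - 1))%:E).
  apply/measurable_EFinP; apply: measurable_funTS.
  by apply: measurable_funM => //; exact: measurable_powR.
have mpdf D : measurable_fun D (fun t : R => (exponential_pdf 2^-1 t)%:E).
  by apply/measurable_EFinP; apply: measurable_funTS; exact: measurable_exponential_pdf.
have pdf0 (t : R) : (0 <= exponential_pdf 2^-1 t)%R by rewrite exponential_pdf_ge0// ltW.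
apply: (@le_lt_trans _ _ ((s^-1)%:E * \int[mu]_(t in `]0%R, 1%R]) (s * t `^ (s - 1))%:E
  + (C * 2)%:E * \int[mu]_t (exponential_pdf 2^-1 t)%:E)); last first.
  rewrite integral_exponential_pdf// mule1 lte_add_pinfty ?ltry//.
  apply: (@le_lt_trans _ _ ((s^-1)%:E * 1)); last by rewrite mule1 ltry.
  by rewrite lee_wpmul2l ?integral_powR_01// lee_fin invr_ge0 ltW.
apply: leeD.
- rewrite -ge0_integralZl//.
  + apply: ge0_le_integral => //.
    * by move=> x _; rewrite lee_fin gammafun_ge0.
    * exact: mg.
    * by apply: measurable_funeM; exact: mf.
    * move=> t /=; rewrite in_itv/= => /andP[t0 _]; rewrite -EFinM lee_fin mulKf ?gt_eqF//.
      by rewrite ler_piMr ?powR_ge0// expR_le1 oppr_le0 ltW.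
  + exact: mf.
  + by move=> x _; rewrite lee_fin mulr_ge0 ?powR_ge0// ltW.
  + by rewrite lee_fin invr_ge0 ltW.
- apply: (@le_trans _ _ ((C * 2)%:E * \int[mu]_(t in `]1%R, +oo[) (exponential_pdf 2^-1 t)%:E)).
    rewrite -ge0_integralZl//; 
      [|exact: mpdf|by move=> x _; rewrite lee_fin|by rewrite lee_fin mulr_ge0].
    apply: ge0_le_integral => //.
    + by move=> x _; rewrite lee_fin gammafun_ge0.
    + exact: mg.
    + by apply: measurable_funeM; exact: mpdf.
    + move=> t /=; rewrite in_itv/= andbT => t1; rewrite -EFinM lee_fin /gammafun.
      rewrite exponential_pdfE; last by rewrite (le_trans _ (ltW t1)).
      rewrite mulrA mulfK// (_ : (- t = t / 2 * - 1 + - 2^-1 * t)%R); last by field.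
      rewrite expRD mulrA ler_wpM2r ?expR_ge0//.
      rewrite mulrN1 expRN ler_pdivrMr ?expR_gt0// hC// ltW//.
  rewrite lee_wpmul2l ?lee_fin ?mulr_ge0//; apply: ge0_subset_integral => //.
    exact: mpdf.
  by move=> x _; rewrite lee_fin.
Qed.

Lemma GammaE (s : R) : (0 < s)%R ->
  \int[mu]_(t in `]0%R, +oo[) (gammafun s t)%:E = (Gamma s)%:E.
Proof.
move=> s0; rewrite /Gamma -/(gammafun s _) fineK// ge0_fin_numE ?Gamma_lty//.
by apply: integral_ge0 => t _; rewrite lee_fin gammafun_ge0.
Qed.

Lemma Gamma_gt0 (s : R) : (0 < s)%R -> (0 < Gamma s)%R.
Proof.
move=> s0; rewrite -lte_fin -GammaE//.
(* A lower bound of the integrand on ]1, 2]: t^(s-1) is at least 1 if s >= 1 and at least 2^(s-1)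
   otherwise. *)
pose c : R := (expR (- 2) * Num.min 1 (2 `^ (s - 1)))%R.
have c0 : (0 < c)%R by rewrite mulr_gt0 ?expR_gt0// lt_min ltr01 powR_gt0.
apply: (@lt_le_trans _ _ c%:E); first by rewrite lte_fin.
apply: (@le_trans _ _ (\int[mu]_(t in `]1%R, 2%R]) (gammafun s t)%:E)).
  rewrite -[leLHS]mule1 (_ : 1 = mu `]1%R, 2%R]); last first.
    rewrite lebesgue_measure_itv/= lte_fin ltr1n -EFinB; congr (_%:E); ring.
  rewrite -integral_cst//; apply: ge0_le_integral => //.
  - by move=> *; rewrite lee_fin ltW.
  - apply/measurable_EFinP; apply: measurable_funTS; exact: measurable_gammafun.
  - move=> t /=; rewrite in_itv/= => /andP[t1 t2]; rewrite lee_fin /c mulrC.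
    rewrite ler_pM ?expR_ge0 ?le_min ?powR_ge0 ?ler01 ?ler_expR ?lerN2//.
    have [s1|s1] := leP 1%R s.
      rewrite ge_min; apply/orP; left; rewrite -[leLHS](powRr0 t).
      by rewrite ler_powR ?subr_ge0// ltW.
    rewrite ge_min; apply/orP; right.
    rewrite -(opprK (s - 1)%R) !(powRN _ (- (s - 1))) lef_pV2 ?posrE ?powR_gt0//; last by lra.
    by rewrite ge0_ler_powR ?nnegrE//; lra.
apply: ge0_subset_integral => //.
- apply/measurable_EFinP; apply: measurable_funTS; exact: measurable_gammafun.
- by move=> *; rewrite lee_fin gammafun_ge0.
- by move=> t /=; rewrite !in_itv/= => /andP[t1 _]; rewrite andbT; lra.
Qed.

(** Substitute c t for t in Euler's integral. With c = 1 + |x|^2 this turns a power weight into a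
    mixture of Gaussians, which factor over the coordinates. *)
Lemma integral_gammafun_scale (s c : R) : (0 < s)%R -> (0 < c)%R ->
  \int[mu]_(t in `]0%R, +oo[) (t `^ (s - 1) * expR (- (c * t)))%:E =
  (c `^ (- s) * Gamma s)%:E.
Proof.
move=> s0 c0.
transitivity (\int[mu]_(t in `]0%R, +oo[) (c `^ (1 - s) * gammafun s (c * t))%:E).
  apply: eq_integral => t /[!inE]/=; rewrite in_itv/= andbT => t0.
  rewrite /gammafun (powRM _ (ltW c0) (ltW t0)) !mulrA -powRD ?(gt_eqF c0) ?implybT//.
  by rewrite (_ : (1 - s + (s - 1) = 0)%R) ?powRr0 ?mul1r//; ring.
transitivity (\int[mu]_(t in `]0%R, +oo[) ((c `^ (1 - s))%:E * (gammafun s (c * t))%:E)).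
  by apply: eq_integral => t _; rewrite EFinM.
rewrite ge0_integralZl//.
- rewrite ge0_integral_scale//; last 2 first.
    exact: measurable_gammafun.
    by move=> x; exact: gammafun_ge0.
  rewrite GammaE// -!EFinM mulrA; congr ((_ * _)%:E).
  rewrite -(powR_inv1 (ltW c0)) -powRD ?(gt_eqF c0) ?implybT//; congr (_ `^ _)%R; ring.
- apply/measurable_EFinP; apply: measurableT_comp => /=; first exact: measurable_gammafun.
  by apply: measurable_funM => //; exact: measurable_id.
- by move=> t _; rewrite lee_fin gammafun_ge0.
- by rewrite lee_fin powR_ge0.
Qed.

End gamma.

(** * The integral test and the theta function *)

Section theta.
Local Open Scope ereal_scope.
Context {R : realType}.
Notation mu := (@lebesgue_measure R).

Lemma integral_itvcy_series (f : R -> R) :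
  measurable_fun setT f -> (forall x, (0 <= f x)%R) ->
  \int[mu]_(x in `[0%R, +oo[) (f x)%:E =
  \sum_(n <oo) \int[mu]_(x in `[n%:R, n.+1%:R[) (f x)%:E.
Proof.
move=> mf f0; pose F n := `[n%:R : R, n.+1%:R[%classic.
have -> : `[0%R, +oo[%classic = \bigcup_n F n.
  apply/seteqP; split => x /=.
    rewrite in_itv/= andbT => x0; exists (Num.trunc x) => //.
    by rewrite /F/= in_itv/= truncn_itv.
  by move=> [n _]; rewrite /F/= !in_itv/= andbT => /andP[+ _]; exact: le_trans.
rewrite ge0_integral_bigcup//.
- by move=> n; exact: measurable_itv.
- by apply/measurable_EFinP; exact: measurable_funTS.
- by move=> x _; rewrite lee_fin.
- apply/trivIsetP => i j _ _ ij; apply/seteqP; split => // x [].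
  rewrite /F/= !in_itv/= => /truncn_def xi /truncn_def xj.
  by move: ij; rewrite -xi -xj eqxx.
Qed.

(** On [n, n+1[ the decreasing function lies between f(n+1) and f(n), and these intervals have
    length 1. *)
Lemma integral_test (f : R -> R) :
  measurable_fun setT f -> (forall x, (0 <= f x)%R) ->
  (forall x y, (0 <= x -> x <= y -> f y <= f x)%R) ->
  \sum_(n <oo) (f n.+1%:R)%:E <= \int[mu]_(x in `[0%R, +oo[) (f x)%:E
    <= \sum_(n <oo) (f n%:R)%:E.
Proof.
move=> mf f0 fd; rewrite integral_itvcy_series//.
have mF n : measurable (`[n%:R : R, n.+1%:R[%classic) by exact: measurable_itv.
have mfn n : measurable_fun `[n%:R : R, n.+1%:R[%classic (fun x => (f x)%:E).
  by apply/measurable_EFinP; exact: measurable_funTS.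
have cF (n : nat) (y : R) : y%:E = \int[mu]_(x in `[n%:R, n.+1%:R[) y%:E.
  rewrite integral_cst//= lebesgue_measure_itv/= lte_fin ltr_nat leqnn.
  by rewrite -EFinB -natrB// subSnn mule1.
apply/andP; split; apply: lee_nneseries => // n _.
- by move=> _; rewrite lee_fin.
- rewrite [leLHS](cF n); apply: ge0_le_integral => //.
  + by move=> x _; rewrite lee_fin.
  + exact: mfn.
  + move=> x /=; rewrite in_itv/= => /andP[nx xn]; rewrite lee_fin fd ?(ltW xn)//.
    by rewrite (le_trans _ nx).
- by move=> _; apply: integral_ge0 => x _; rewrite lee_fin.
- rewrite [leRHS](cF n); apply: ge0_le_integral => //.
  + by move=> x _; rewrite lee_fin.
  + exact: mfn.
  + by move=> x /=; rewrite in_itv/= => /andP[nx xn]; rewrite lee_fin fd.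
Qed.

Lemma integral_gauss_scale (u : R) : (0 < u)%R ->
  \int[mu]_(x in `[0%R, +oo[) (expR (- (u * x ^+ 2)))%:E =
  (Num.sqrt (pi / u) / 2)%:E.
Proof.
move=> u0; have su0 : (0 < Num.sqrt u)%R by rewrite sqrtr_gt0.
have mE : measurable_fun setT (fun x : R => expR (- (u * x ^+ 2))).
  by apply: measurableT_comp => //; apply: measurableT_comp => //; apply: measurable_funM.
(* The scaling lemma concerns the open half-line, so the endpoint 0 is removed here and put back to
   use the known Gaussian integral. *)
rewrite -integral_itv_obnd_cbnd; last first.
  by apply/measurable_EFinP; exact: measurable_funTS.
transitivity (\int[mu]_(x in `]0%R, +oo[) (gauss_fun (Num.sqrt u * x))%:E).
  by apply: eq_integral => x _; rewrite /gauss_fun exprMn sqr_sqrtr ?(ltW u0).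
rewrite (@ge0_integral_scale _ _ gauss_fun)//; last 2 first.
- exact: measurable_gauss_fun.
- by move=> x; exact: gauss_fun_ge0.
rewrite integral_itv_obnd_cbnd; last first.
  by apply/measurable_EFinP; apply: measurable_funTS; exact: measurable_gauss_fun.
rewrite integral0y_gauss -EFinM sqrtrM ?pi_ge0// sqrtrV ?(ltW u0)//.
by rewrite mulrA (mulrC _^-1%R).
Qed.

Lemma esum_int (f : int -> \bar R) : (forall k, 0 <= f k) ->
  \esum_(k in [set: int]) f k =
  \sum_(n <oo) f (Posz n) + \sum_(n <oo) f (Negz n).
Proof.
move=> f0; rewrite (esumID (range Posz))// !setTI (_ : ~` range Posz = range Negz); last first.
  apply/seteqP; split; first by move=> [n|n] nP; [case: nP; exists n|exists n].
  by move=> _ [n _ <-] [].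
rewrite !esum_image; try by move=> m n _ _ [].
by rewrite !nneseries_esumT.
Qed.

(** Jacobi's theta_3 at nome exp(-u); meaningful for u > 0, where the series converges. *)
Definition theta (u : R) : R :=
  fine (\esum_(k in [set: int]) (expR (- (u * k%:~R ^+ 2)))%:E).

(** Let B be the sum over n >= 1 and J half of sqrt(pi/u). By symmetry theta(u) = 1 + 2B, and the
    integral test gives B <= J <= 1 + B, hence finiteness and both inequalities. *)
Lemma theta_bounds (u : R) : (0 < u)%R ->
  \esum_(k in [set: int]) (expR (- (u * k%:~R ^+ 2)))%:E = (theta u)%:E /\
  (`|theta u - Num.sqrt (pi / u)| <= 1)%R.
Proof.
move=> u0.
pose f (x : R) : R := expR (- (u * x ^+ 2)).
have mf : measurable_fun setT f.
  by apply: measurableT_comp => //; apply: measurableT_comp => //; apply: measurable_funM.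
have fd (x y : R) : (0 <= x -> x <= y -> f y <= f x)%R.
  move=> x0 xy; rewrite /f ler_expR lerN2 ler_pM2l// ler_sqr ?nnegrE//.
  exact: le_trans xy.
have f0 x : (0 <= f x)%R by exact: expR_ge0.
have /andP[] := @integral_test f mf f0 fd.
rewrite integral_gauss_scale//.
set J := (Num.sqrt _ / 2)%R => B1 B2.
set B := \sum_(n <oo) (f n.+1%:R)%:E in B1 *.
have A1B : \sum_(n <oo) (f n%:R)%:E = 1 + B.
  rewrite nneseries_recl//=; last by move=> n _; rewrite lee_fin.
  congr (_ + _); first by rewrite /f expr0n mulr0 oppr0 expR0.
  rewrite -(nneseries_addn (f := fun n => (f n%:R)%:E)); last by move=> n; rewrite lee_fin.
  by apply: eq_eseriesr => n _; rewrite addn1.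
have E : \esum_(k in [set: int]) (f k%:~R)%:E = 1 + B + B.
  rewrite esum_int; last by move=> k; rewrite lee_fin.
  rewrite -A1B; congr (_ + _).
  by apply: eq_eseriesr => n _; rewrite /f NegzE mulrNz sqrrN.
have B0 : 0 <= B by apply: nneseries_ge0 => n _; rewrite lee_fin.
have Bfin : B \is a fin_num by rewrite ge0_fin_numE// (le_lt_trans B1) ?ltry.
rewrite A1B in B2; rewrite /theta -/(f _) E.
move: B0 B1 B2; rewrite -(fineK Bfin) -!EFinD !lee_fin; set b := fine B => b0 b1 b2.
split => //=; rewrite (_ : Num.sqrt _ = 2 * J)%R; last by rewrite /J; field.
rewrite ler_norml; apply/andP; split; lra.
Qed.

End theta.

(** * Integral representation of the lattice sum *)

Section lattice.
Local Open Scope ereal_scope.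
Context {R : realType}.
Notation mu := (@lebesgue_measure R).

(** Telescoping: factors are replaced by r one at a time. Each replacement costs at most e, and the
    remaining factors are bounded by r + 1 because e <= 1. *)
Lemma prod_dist (d : nat) (x : 'I_d -> R) (r e : R) :
  (0 <= r -> 0 <= e <= 1 -> (forall i, `|x i - r| <= e) ->
  `|\prod_(i < d) x i - r ^+ d| <= e * d%:R * (r + 1) ^+ d)%R.
Proof.
move=> r0 /andP[e0 e1]; elim: d x => [|d IHd] x xr.
  by rewrite big_ord0 expr0 subrr normr0 mulr0 mul0r.
rewrite big_ord_recl exprS.
set Q := (\prod_(i < d) _)%R.
have -> : (x ord0 * Q - r * r ^+ d = x ord0 * (Q - r ^+ d) + (x ord0 - r) * r ^+ d)%R by ring.
have hQ := IHd (fun i => x (lift ord0 i)) (fun i => xr (lift ord0 i)).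
have x0 : (`|x ord0| <= r + 1)%R.
  have := xr ord0; rewrite !ler_norml => /andP[h1 h2]; apply/andP; split; lra.
have rd : (r ^+ d <= (r + 1) ^+ d)%R by rewrite lerXn2r ?nnegrE ?addr_ge0// lerDl.
have r1 : (0 <= (r + 1) ^+ d)%R by rewrite exprn_ge0// addr_ge0.
rewrite (le_trans (ler_normD _ _))// !normrM (ger0_norm (exprn_ge0 d r0)).
apply: (@le_trans _ _ ((r + 1) * (e * d%:R * (r + 1) ^+ d) + e * (r + 1) ^+ d))%R.
  by apply: lerD; apply: ler_pM => //; exact: exprn_ge0.
rewrite -natr1 exprS.
(* This quantity is exactly the slack between the two sides. *)
have : (0 <= e * r * (r + 1) ^+ d)%R by rewrite !mulr_ge0.
by lra.
Qed.

(** At r = sqrt(pi/t) this leaves only a multiple of t^(-d/2) and a constant, so that integrating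
    the error produces just two Gamma values. *)
Lemma exprD1_le (d : nat) (r : R) : (0 <= r -> (r + 1) ^+ d <= 2 ^+ d * (r ^+ d + 1))%R.
Proof.
move=> r0; have [r1|/ltW r1] := leP r 1%R.
  apply: (@le_trans _ _ (2 ^+ d))%R.
    by rewrite lerXn2r ?nnegrE ?addr_ge0//; lra.
  by rewrite ler_peMr ?exprn_ge0// lerDr exprn_ge0.
apply: (@le_trans _ _ ((2 * r) ^+ d))%R.
  by rewrite lerXn2r ?nnegrE ?addr_ge0 ?mulr_ge0//; lra.
by rewrite exprMn ler_wpM2l ?exprn_ge0// lerDl.
Qed.

Definition theta_prod (d : nat) (a : 'I_d -> R) (t : R) : R :=
  (\prod_(i < d) theta (t / a i ^+ 2))%R.

Lemma weight_ge0 (d : nat) (m : R) (a : 'I_d -> R) k : (0 <= weight m a k)%R.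
Proof. exact: powR_ge0. Qed.

Lemma quad_ge1 (d : nat) (a : 'I_d -> R) (k : Zd d) :
  (1 <= 1 + \sum_(i < d) ((k i)%:~R ^+ 2 / a i ^+ 2))%R.
Proof. by rewrite lerDl sumr_ge0// => i _; rewrite divr_ge0 ?sqr_ge0. Qed.

Lemma quad_gt0 (d : nat) (a : 'I_d -> R) (k : Zd d) :
  (0 < 1 + \sum_(i < d) ((k i)%:~R ^+ 2 / a i ^+ 2))%R.
Proof. exact: lt_le_trans (quad_ge1 d a k). Qed.

Definition gauss_term (d : nat) (s : R) (a : 'I_d -> R) (k : Zd d) (t : R) : R :=
  (gammafun s t * \prod_(i < d) expR (- (t / a i ^+ 2 * (k i)%:~R ^+ 2)))%R.

Lemma gauss_term_ge0 d s a k t : (0 <= @gauss_term d s a k t)%R.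
Proof.
by rewrite mulr_ge0 ?gammafun_ge0// prodr_ge0// => i _; exact: expR_ge0.
Qed.

Lemma gauss_termE d s a k t : @gauss_term d s a k t =
  (t `^ (s - 1) * expR (- ((1 + \sum_(i < d) ((k i)%:~R ^+ 2 / a i ^+ 2)) * t)))%R.
Proof.
rewrite /gauss_term /gammafun -expR_sum -mulrA -expRD; congr (_ * expR _)%R.
rewrite sumrN mulrDl mul1r opprD mulr_suml; congr (_ - _)%R.
by apply: eq_bigr => i _; rewrite mulrAC [RHS]mulrAC (mulrC t).
Qed.

Lemma measurable_gauss_term d s a k D :
  measurable_fun D (fun t : R => (@gauss_term d s a k t)%:E).
Proof.
apply/measurable_EFinP; apply: measurable_funTS.
rewrite (_ : gauss_term d s a k = fun t => (t `^ (s - 1) *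
  expR (- ((1 + \sum_(i < d) ((k i)%:~R ^+ 2 / a i ^+ 2)) * t)))%R); last first.
  by apply/funext => t; exact: gauss_termE.
apply: measurable_funM; first exact: measurable_powR.
apply: measurableT_comp => //; apply: measurableT_comp => //.
Qed.

Lemma integral_gauss_term d (m : R) (a : 'I_d -> R) (k : Zd d) :
  (0 < m)%R ->
  \int[mu]_(t in `]0%R, +oo[) (gauss_term d ((m + d%:R) / 2) a k t)%:E =
  (Gamma ((m + d%:R) / 2) * weight m a k)%:E.
Proof.
move=> m0.
have s0 : (0 < (m + d%:R) / 2)%R by rewrite divr_gt0// ltr_wpDr.
rewrite [in RHS]mulrC /weight -integral_gammafun_scale ?quad_gt0//.
by apply: eq_integral => t _; rewrite gauss_termE.
Qed.

Lemma esum_gauss_term d (s : R) (a : 'I_d -> R) (t : R) :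
  (forall i, 0 < a i)%R -> (0 < t)%R ->
  \esum_(k in [set: Zd d]) (gauss_term d s a k t)%:E =
  (gammafun s t * theta_prod d a t)%:E.
Proof.
move=> a0 t0.
transitivity (\esum_(k in [set: {ffun 'I_d -> int}]) ((gammafun s t)%:E *
    (\prod_(i < d) expR (- (t / a i ^+ 2 * (k i)%:~R ^+ 2)))%:E)).
  by apply: eq_esum => k _; rewrite -EFinM.
rewrite ge0_esumZl ?gammafun_ge0//; last first.
  by move=> k; rewrite lee_fin prodr_ge0// => i _; exact: expR_ge0.
rewrite (@esum_prod_ffun _ int d
  (fun i j => expR (- (t / a i ^+ 2 * j%:~R ^+ 2))) (fun i => theta (t / a i ^+ 2))) ?EFinM//.
- move=> i; apply: (theta_bounds _ _).1.
  by rewrite divr_gt0// exprn_gt0.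
Qed.

(** For t > 0 the function is a countable sum of measurable Gaussian terms. *)
Lemma measurable_theta_prod d (s : R) (a : 'I_d -> R) : (forall i, 0 < a i)%R ->
  measurable_fun (`]0%R, +oo[%classic : set R) (fun t : R => (gammafun s t * theta_prod d a t)%:E).
Proof.
move=> a0; apply: (eq_measurable_fun
  (fun t => \esum_(k in [set: {ffun 'I_d -> int}]) (gauss_term d s a k t)%:E)).
  move=> t /[!inE]/=; rewrite in_itv/= andbT => t0.
  exact: esum_gauss_term.
apply: measurable_fun_esum => //.
- by move=> k; exact: measurable_gauss_term.
- by move=> k t _; rewrite lee_fin gauss_term_ge0.
Qed.

Lemma Gamma_esum_weight d (m : R) (a : 'I_d -> R) :
  (forall i, 0 < a i)%R -> (0 < m)%R ->
  ((Gamma ((m + d%:R) / 2))%:E * (\esum_(k in [set: Zd d]) (weight m a k)%:E) =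
  \int[mu]_(t in `]0%R, +oo[) (gammafun ((m + d%:R) / 2) t * theta_prod d a t)%:E)%E.
Proof.
move=> a0 m0.
have s0 : (0 < (m + d%:R) / 2)%R by rewrite divr_gt0// ltr_wpDr.
transitivity (\esum_(k in [set: {ffun 'I_d -> int}])
   ((Gamma ((m + d%:R) / 2))%:E * (weight m a k)%:E)).
  by rewrite ge0_esumZl ?(ltW (Gamma_gt0 _ s0))// => k; rewrite lee_fin weight_ge0.
transitivity (\esum_(k in [set: {ffun 'I_d -> int}])
   \int[mu]_(t in `]0%R, +oo[) (gauss_term d ((m + d%:R) / 2) a k t)%:E).
  by apply: eq_esum => k _; rewrite integral_gauss_term.
rewrite -ge0_integral_esum//.
- apply: eq_integral => t /[!inE]/=; rewrite in_itv/= andbT => t0.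
  exact: esum_gauss_term.
- by move=> k; exact: measurable_gauss_term.
- by move=> k t _; rewrite lee_fin gauss_term_ge0.
Qed.

(** Put r = sqrt(pi/t). Dividing the theta bound at t/a_i^2 by a_i puts each factor within 1/a_i <=
    e of r; then [prod_dist] applies, with r^d = (pi/t)^(d/2). *)
Lemma theta_prod_dist d (a : 'I_d -> R) (e t : R) : (0 < e <= 1)%R ->
  (forall i, e^-1 <= a i)%R -> (0 < t)%R ->
  (`|theta_prod d a t / \prod_(i < d) a i - pi `^ (d%:R / 2) * t `^ (- (d%:R / 2))| <=
    e * (d%:R * 2 ^+ d) * (pi `^ (d%:R / 2) * t `^ (- (d%:R / 2)) + 1))%R.
Proof.
move=> /andP[e0 e1] ea t0.
have a0 i : (0 < a i)%R by rewrite (lt_le_trans _ (ea i))// invr_gt0.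
pose r := Num.sqrt (pi / t).
have r0 : (0 <= r)%R by exact: sqrtr_ge0.
have -> : (pi `^ (d%:R / 2) * t `^ (- (d%:R / 2)) = r ^+ d)%R.
  have tV0 : (0 <= t^-1)%R by rewrite invr_ge0 ltW.
  rewrite -(powR_mulrn d r0) /r -powR12_sqrt ?mulr_ge0 ?pi_ge0// -powRrM (mulrC 2^-1%R).
  by rewrite powRM ?pi_ge0// -(powR_inv1 (ltW t0)) -powRrM mulN1r.
rewrite /theta_prod -prodf_div.
apply: (@le_trans _ _ (e * d%:R * (r + 1) ^+ d))%R.
  apply: prod_dist => //; first by rewrite ltW.
  move=> i; have ai := a0 i.
  have [] := theta_bounds (t / a i ^+ 2)%R _; first by rewrite divr_gt0// exprn_gt0.
  move=> _; rewrite (_ : Num.sqrt _ = r * a i)%R; last first.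
    rewrite invfM invrK mulrA sqrtrM ?divr_ge0 ?pi_ge0 ?(ltW t0)//.
    by rewrite sqrtr_sqr ger0_norm// ltW.
  rewrite (_ : theta _ / a i - r = (theta (t / a i ^+ 2) - r * a i) / a i)%R; last first.
    by field; rewrite gt_eqF.
  rewrite normrM normfV (ger0_norm (ltW ai)) => h.
  rewrite ler_pdivrMr// (le_trans h)//.
  by rewrite -ler_pdivrMl// mulr1.
rewrite -!mulrA ler_wpM2l ?(ltW e0)// ler_wpM2l//.
exact: exprD1_le.
Qed.

End lattice.

(** * Asymptotics and convergence of the lattice sum *)

Section estimate.
Local Open Scope ereal_scope.
Context {R : realType}.
Notation mu := (@lebesgue_measure R).

Lemma measurable_gammafun_comb (s1 s2 A B : R) D :
  measurable_fun D (fun t => (A * gammafun s1 t + B * gammafun s2 t)%:E).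
Proof.
apply/measurable_EFinP; apply: measurable_funTS.
by apply: measurable_funD; apply: measurable_funM => //; exact: measurable_gammafun.
Qed.

Lemma integral_gammafun_lin (s1 s2 A B : R) :
  (0 < s1)%R -> (0 < s2)%R -> (0 <= A)%R -> (0 <= B)%R ->
  \int[mu]_(t in `]0%R, +oo[) (A * gammafun s1 t + B * gammafun s2 t)%:E =
  (A * Gamma s1 + B * Gamma s2)%:E.
Proof.
move=> s10 s20 A0 B0.
have mg s D : measurable_fun D (fun t : R => (gammafun s t)%:E).
  by apply/measurable_EFinP; apply: measurable_funTS; exact: measurable_gammafun.
transitivity (\int[mu]_(t in `]0%R, +oo[)
    (A%:E * (gammafun s1 t)%:E + B%:E * (gammafun s2 t)%:E)).
  by apply: eq_integral => t _; rewrite -!EFinM.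
have g0 s t : 0 <= (gammafun s t)%:E by rewrite lee_fin gammafun_ge0.
rewrite ge0_integralD//.
- rewrite !ge0_integralZl ?lee_fin//; try exact: mg.
  by rewrite !GammaE// -!EFinM.
- by move=> t _; rewrite mule_ge0.
- by apply: measurable_funeM; exact: mg.
- by move=> t _; rewrite mule_ge0.
- by apply: measurable_funeM; exact: mg.
Qed.

(** The pointwise bound on the theta product is integrated against t^(s-1) exp(-t), s = (m+d)/2, and
    divided by P G. Finiteness of the sum is part of the conclusion, since it comes from the same
    bound. *)
Lemma esum_weight_dist d (m e : R) (a : 'I_d -> R) : (0 < m)%R ->
  (0 < e <= 1)%R -> (forall i, e^-1 <= a i)%R ->
  let L := (pi `^ (d%:R / 2) * Gamma (m / 2))%R in
  let G := Gamma ((m + d%:R) / 2) in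
  let P := (\prod_(i < d) a i)%R in
  exists2 S : R, \esum_(k in [set: Zd d]) (weight m a k)%:E = S%:E &
  (`|S / P - L / G| <= e * (d%:R * 2 ^+ d) * ((L + G) / G))%R.
Proof.
move=> m0 /[dup] e01 /andP[e0 e1] ea L G P.
have a0 i : (0 < a i)%R by rewrite (lt_le_trans _ (ea i))// invr_gt0.
pose s := ((m + d%:R) / 2)%R; pose K := (e * (d%:R * 2 ^+ d))%R.
have s0 : (0 < s)%R by rewrite divr_gt0// ltr_wpDr.
have m20 : (0 < m / 2)%R by rewrite divr_gt0.
have P0 : (0 < P)%R by exact: prodr_gt0.
have G0 : (0 < G)%R by exact: Gamma_gt0.
have L0 : (0 <= L)%R by rewrite mulr_ge0 ?powR_ge0// ltW// Gamma_gt0.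
have K0 : (0 <= K)%R by rewrite !mulr_ge0 ?exprn_ge0// ltW.
pose c := (pi `^ (d%:R / 2) : R)%R.
have c0 : (0 <= c)%R by exact: powR_ge0.
have GS := Gamma_esum_weight d m a a0 m0.
set I := \int[mu]_(t in `]0%R, +oo[) _ in GS.
(* The factor t^(-d/2) lowers the Gamma parameter from s to s - d/2 = m/2. *)
have gm (t : R) : (0 < t)%R -> (gammafun s t * t `^ (- (d%:R / 2)) = gammafun (m / 2) t)%R.
  move=> t0; rewrite /gammafun mulrAC -powRD ?(gt_eqF t0) ?implybT//.
  by congr (_ `^ _ * _)%R; rewrite /s; field.
have bnd (t : R) : (0 < t)%R ->
    (`|gammafun s t * theta_prod d a t - P * c * gammafun (m / 2) t| <=
     P * K * c * gammafun (m / 2) t + P * K * gammafun s t)%R.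
  move=> t0; have := theta_prod_dist d a e t e01 ea t0.
  rewrite -/P -/K -/c => h.
  have g0 := gammafun_ge0 s t.
  rewrite -(gm t t0).
  have -> : (gammafun s t * theta_prod d a t - P * c * (gammafun s t * t `^ (- (d%:R / 2))) =
     (gammafun s t * P) * (theta_prod d a t / P - c * t `^ (- (d%:R / 2))))%R.
    by field; rewrite gt_eqF.
  have gP0 : (0 <= gammafun s t * P)%R by rewrite mulr_ge0// ltW.
  rewrite normrM (ger0_norm gP0).
  apply: (le_trans (ler_wpM2l gP0 h)); rewrite le_eqVlt; apply/orP; left; apply/eqP; ring.
have mth := measurable_theta_prod d s a a0.
have th0 (t : R) : (0 < t)%R -> (0 <= gammafun s t * theta_prod d a t)%R.
  move=> t0; rewrite -lee_fin -esum_gauss_term//; apply: esum_ge0 => k _.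
  by rewrite lee_fin gauss_term_ge0.
have U : I <= (P * (c * (1 + K)) * Gamma (m / 2) + P * K * G)%:E.
  rewrite -integral_gammafun_lin ?mulr_ge0 ?addr_ge0 ?(ltW P0) ?(ltW e0)//.
  apply: ge0_le_integral => //.
  - by move=> t /=; rewrite in_itv/= andbT lee_fin; exact: th0.
  - exact: measurable_gammafun_comb.
  - move=> t /=; rewrite in_itv/= andbT lee_fin => t0.
    by have := bnd t t0; rewrite ler_norml => /andP[_]; lra.
have I0 : 0 <= I.
  by apply: integral_ge0 => t /=; rewrite in_itv/= andbT lee_fin; exact: th0.
have Ifin : I \is a fin_num by rewrite ge0_fin_numE// (le_lt_trans U) ?ltry.
(* The error is moved to the right so that all integrands are nonnegative; the term [0 * G] gives
   the left side the form of [integral_gammafun_lin]. *)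
have Lo : (P * c * Gamma (m / 2) + 0 * G)%:E <=
    I + (P * K * c * Gamma (m / 2) + P * K * G)%:E.
  rewrite -!integral_gammafun_lin ?mulr_ge0 ?(ltW P0) ?(ltW e0)//.
  rewrite -ge0_integralD//; last 3 first.
  - by move=> t /=; rewrite in_itv/= andbT lee_fin; exact: th0.
  - by move=> t _; rewrite lee_fin addr_ge0 ?mulr_ge0 ?powR_ge0 ?expR_ge0 ?(ltW P0) ?(ltW e0).
  - exact: measurable_gammafun_comb.
  apply: ge0_le_integral => //.
  - by move=> t _; rewrite lee_fin mul0r addr0 ?mulr_ge0 ?powR_ge0 ?expR_ge0 ?(ltW P0) ?(ltW e0).
  - exact: measurable_gammafun_comb.
  - apply: emeasurable_funD; [exact: mth|exact: measurable_gammafun_comb].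
  - move=> t /=; rewrite in_itv/= andbT lee_fin => t0.
    by have := bnd t t0; rewrite ler_norml => /andP[+ _]; lra.
exists (G^-1 * fine I)%R.
  rewrite EFinM fineK// -GS muleA -EFinM mulVf ?gt_eqF// mul1e//.
move: U Lo; rewrite -(fineK Ifin) -!EFinD !lee_fin; set J := fine I => U Lo.
have -> : (G^-1 * J / P - L / G = (J - P * L) / (P * G))%R by field; rewrite !gt_eqF.
rewrite normrM normfV (ger0_norm (ltW (mulr_gt0 P0 G0))) ler_pdivrMr ?mulr_gt0//.
have -> : (K * ((L + G) / G) * (P * G) = P * K * (L + G))%R by field; rewrite gt_eqF.
by rewrite ler_norml /L -/c; apply/andP; split; lra.
Qed.

Lemma le_weight d (m : R) (a b : 'I_d -> R) (k : Zd d) : (0 <= m)%R ->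
  (forall i, 0 < a i <= b i)%R -> (weight m a k <= weight m b k)%R.
Proof.
move=> m0 ab; rewrite /weight !(powRN _ ((m + d%:R) / 2)).
rewrite lef_pV2 ?posrE ?powR_gt0 ?quad_gt0//.
rewrite ge0_ler_powR ?nnegrE ?(ltW (quad_gt0 _ _ _)) ?divr_ge0 ?addr_ge0//.
rewrite lerD2l ler_sum// => i _; have /andP[a0 aibi] := ab i.
have b0 := lt_le_trans a0 aibi.
by rewrite ler_wpM2l ?sqr_ge0// lef_pV2 ?posrE ?exprn_gt0// lerXn2r ?nnegrE ?(ltW a0) ?(ltW b0).
Qed.

Lemma weight_gt0 d (m : R) (a : 'I_d -> R) (k : Zd d) : (0 < weight m a k)%R.
Proof. by rewrite powR_gt0 ?quad_gt0. Qed.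

(** The estimate with e = 1 requires scales at least 1, so it is applied to a_i + 1; the weights
    only grow when the scales do. *)
Lemma esum_weight_lty d (m : R) (a : 'I_d -> R) : (0 < m)%R -> (forall i, 0 < a i)%R ->
  \esum_(k in [set: Zd d]) (weight m a k)%:E < +oo.
Proof.
move=> m0 a0.
have [] := @esum_weight_dist d m 1 (fun i => a i + 1)%R m0.
- by rewrite ltr01 lexx.
- by move=> i; rewrite invr1 lerDr ltW.
move=> S S1 _; apply: (@le_lt_trans _ _ S%:E); last exact: ltry.
rewrite -S1; apply: le_esum => k _; rewrite lee_fin le_weight ?(ltW m0)// => i.
by rewrite a0 lerDl ler01.
Qed.

End estimate.

(** * Signed sums and the tangent inequality *)

Section series.
Context {R : realType}.

Lemma sums_to_ge0 (T : choiceType) (f : T -> R) (l : R) : (forall k, 0 <= f k) ->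
  sums_to f l <-> (\esum_(k in [set: T]) (f k)%:E = l%:E)%E.
Proof.
move=> f0; have f0E : (0 <= \esum_(k in [set: T]) (f k)%:E)%E.
  by apply: esum_ge0 => k _; rewrite lee_fin.
have absE : (\esum_(k in [set: T]) (`|f k|)%:E = \esum_(k in [set: T]) (f k)%:E)%E.
  by apply: eq_esum => k _; rewrite ger0_norm.
have serE : series_sum f = fine (\esum_(k in [set: T]) (f k)%:E)%E.
  rewrite /series_sum [X in _ - fine X]esum1/= ?subr0.
    by congr fine; apply: eq_esum => k _; rewrite max_l.
  by move=> k _; rewrite max_r// oppr_le0.
rewrite /sums_to /abs_summable absE serE; split=> [[f1 <-]|->].
  by rewrite fineK// ge0_fin_numE.
by rewrite ltry.
Qed.

(** Reindexing by [e] exchanges the sums of the positive and negative parts, so their difference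
    vanishes. *)
Lemma sums_to_odd (T : choiceType) (f : T -> R) (e : T -> T) : involutive e ->
  (forall k, f (e k) = - f k) -> abs_summable f -> sums_to f 0.
Proof.
move=> eK fe fs; split => //; rewrite /series_sum.
rewrite (reindex_esum [set: T] [set: T] e (fun k => (Num.max (f k) 0)%:E)).
  by under eq_esum do rewrite fe; rewrite subrr.
by rewrite setTT_bijective; exact: inv_bij.
Qed.

Lemma norm_intr_le_sqr (k : int) : `|k%:~R : R| <= k%:~R ^+ 2.
Proof.
rewrite -intr_norm -(rmorphXn (intr : int -> R)) ler_int -real_normK ?num_real//.
have [->|k0] := eqVneq k 0; first by rewrite normr0.
by rewrite expr2 ler_peMr// -gtz0_ge1 normr_gt0.
Qed.

(** Young's inequality for x^q and y^(1-q) with exponents 1/q and 1/(1-q), multiplied by y^(q-1).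
    The terms are arranged without subtraction so that they can be summed in the extended reals. *)
Lemma powR_tangent (q x y : R) : 0 < q < 1 -> 0 <= x -> 0 < y ->
  x `^ q + q * y `^ (q - 1) * y <= y `^ q + q * y `^ (q - 1) * x.
Proof.
move=> /andP[q0 q1] x0 y0.
have q1' : 0 < 1 - q by lra.
have := @conjugate_powR R (x `^ q) (y `^ (1 - q)) q^-1 (1 - q)^-1
  (powR_ge0 _ _) (powR_ge0 _ _).
rewrite !invr_gt0 !invrK => /(_ q0 q1'); rewrite -!powRrM !divff ?gt_eqF// !powRr1 ?(ltW y0)//.
move=> /(_ ltac:(ring)) h.
have {}h := ler_wpM2r (powR_ge0 y (q - 1)) h.
have yy : y `^ (1 - q) * y `^ (q - 1) = 1.
  rewrite -powRD ?(gt_eqF y0) ?implybT//.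
  by rewrite (_ : 1 - q + (q - 1) = 0) ?powRr0//; ring.
have yq : y `^ (q - 1) * y = y `^ q by rewrite mulrC mulr_powRB1// ltW.
have {}h : x `^ q <= (x * q + y * (1 - q)) * y `^ (q - 1).
  by move: h; rewrite -[leLHS]mulrA yy mulr1.
by rewrite -yq; lra.
Qed.

End series.

(** * Moments of p and its maximality *)

Section maximality.
Context {R : realType} (d : nat).
Implicit Types (a : 'I_d -> R) (k : Zd d).

Lemma esum_quad a (p : Zd d -> R) (u : 'I_d -> R) : (forall i, 0 < a i) ->
  (forall k, 0 <= p k) ->
  (\esum_(k in [set: Zd d]) (p k)%:E = 1)%E ->
  (forall i, \esum_(k in [set: Zd d]) ((k i)%:~R ^+ 2 * p k)%:E = (u i)%:E)%E ->
  (\esum_(k in [set: Zd d])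
     ((1 + \sum_(i < d) ((k i)%:~R ^+ 2 / a i ^+ 2)) * p k)%:E =
   (1 + \sum_(i < d) (u i / a i ^+ 2))%:E)%E.
Proof.
move=> a0 p0 p1 pu.
have t0 k i : (0 <= (a i ^- 2 * ((k i)%:~R ^+ 2 * p k))%:E)%E.
  by rewrite lee_fin mulr_ge0 ?invr_ge0 ?sqr_ge0// mulr_ge0 ?sqr_ge0.
transitivity (\esum_(k in [set: Zd d])
    ((p k)%:E + \sum_(i < d) (a i ^- 2 * ((k i)%:~R ^+ 2 * p k))%:E))%E.
  apply: eq_esum => k _; rewrite sumEFin -EFinD; congr (_%:E).
  rewrite mulrDl mul1r mulr_suml; congr (_ + _); apply: eq_bigr => i _.
  by rewrite mulrA (mulrC (a i ^- 2)).
rewrite esumD; last 2 first.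
- by move=> k _; rewrite lee_fin.
- by move=> k _; apply: sume_ge0 => i _; exact: t0.
rewrite p1 EFinD; congr (_ + _)%E; rewrite -sumEFin esum_sum//.
apply: eq_bigr => i _.
transitivity (\esum_(k in [set: Zd d])
    ((a i ^- 2)%:E * ((k i)%:~R ^+ 2 * p k)%:E))%E.
  by apply: eq_esum => k _; rewrite -EFinM.
rewrite (@ge0_esumZl R {ffun 'I_d -> int}) ?invr_ge0 ?sqr_ge0//; last first.
  by move=> k; rewrite lee_fin mulr_ge0 ?sqr_ge0.
by rewrite pu -EFinM mulrC.
Qed.

(** A quadratic factor raises the exponent by 1, which amounts to lowering m by 2. Convergence of
    the second moments thus follows from m - 2 > 0. *)
Lemma quad_weight (m : R) a k :
  (1 + \sum_(i < d) ((k i)%:~R ^+ 2 / a i ^+ 2)) * weight m a k = weight (m - 2) a k.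
Proof.
rewrite /weight; set Q := 1 + _; have Q0 : 0 < Q by exact: quad_gt0.
rewrite -{1}(powRr1 (ltW Q0)) -powRD ?(gt_eqF Q0) ?implybT//.
by congr (_ `^ _); field.
Qed.

Lemma sqr_weight_le (m : R) a k i : (forall j, 0 < a j) ->
  (k i)%:~R ^+ 2 * weight m a k <= a i ^+ 2 * weight (m - 2) a k.
Proof.
move=> a0; rewrite -quad_weight mulrA ler_wpM2r ?weight_ge0// mulrC -ler_pdivrMr ?exprn_gt0//.
rewrite (bigD1 i)//= addrCA lerDl addr_ge0// sumr_ge0// => j _.
by rewrite divr_ge0 ?sqr_ge0.
Qed.

Section pdist.
Variables (m : R) (a : 'I_d -> R).
Hypotheses (m2 : 2 < m) (a0 : forall i, 0 < a i).

Let m0 : 0 < m. Proof. by rewrite (lt_trans _ m2). Qed.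

Lemma esum_weight_fmd : (\esum_(k in [set: Zd d]) (weight m a k)%:E = (fmd m a)%:E)%E.
Proof.
rewrite /fmd fineK// ge0_fin_numE ?esum_weight_lty//.
by apply: esum_ge0 => k _; rewrite lee_fin weight_ge0.
Qed.

Lemma fmd_gt0 : 0 < fmd m a.
Proof.
pose z : Zd d := [ffun=> 0].
rewrite -lte_fin -esum_weight_fmd.
apply: (@lt_le_trans _ _ (weight m a z)%:E); first by rewrite lte_fin weight_gt0.
apply: esum_ge; exists [set z]; first by split.
by rewrite fsbig_set1.
Qed.

Lemma pdist_gt0 k : 0 < pdist m a k.
Proof. by rewrite mulr_gt0 ?invr_gt0 ?fmd_gt0 ?weight_gt0. Qed.

Lemma pdist_prob : prob_distr (pdist m a).
Proof.
have p0 k := ltW (pdist_gt0 k); split => //.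
apply/sums_to_ge0 => //.
transitivity (\esum_(k in [set: Zd d]) (((fmd m a)^-1)%:E * (weight m a k)%:E))%E.
  by apply: eq_esum => k _; rewrite -EFinM.
rewrite (@ge0_esumZl R {ffun 'I_d -> int}) ?invr_ge0 ?(ltW fmd_gt0)//; last first.
  by move=> k; rewrite lee_fin weight_ge0.
by rewrite esum_weight_fmd -EFinM mulVf ?gt_eqF ?fmd_gt0.
Qed.

Lemma pdist_moment2_lty i :
  (\esum_(k in [set: Zd d]) ((k i)%:~R ^+ 2 * pdist m a k)%:E < +oo)%E.
Proof.
apply: (@le_lt_trans _ _ (((fmd m a)^-1 * a i ^+ 2)%:E *
  \esum_(k in [set: Zd d]) (weight (m - 2) a k)%:E)%E); last first.
  apply: lte_mul_pinfty => //; last by apply: esum_weight_lty; rewrite ?subr_gt0.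
  by rewrite lee_fin mulr_ge0 ?sqr_ge0 ?invr_ge0 ?(ltW fmd_gt0).
apply: (@le_trans _ _ (\esum_(k in [set: Zd d])
    (((fmd m a)^-1 * a i ^+ 2)%:E * (weight (m - 2) a k)%:E))%E).
  apply: le_esum => k _; rewrite -EFinM lee_fin /pdist [leLHS]mulrCA -[leRHS]mulrA.
  by rewrite ler_wpM2l ?invr_ge0 ?(ltW fmd_gt0)// sqr_weight_le.
rewrite (@ge0_esumZl R {ffun 'I_d -> int})//.
  by rewrite mulr_ge0 ?sqr_ge0 ?invr_ge0 ?(ltW fmd_gt0).
by move=> k; rewrite lee_fin weight_ge0.
Qed.

(** The summand is odd under k -> -k, and |k_i| <= k_i^2 for integers bounds the absolute first
    moment by the second. *)
Lemma pdist_mean i : sums_to (fun k : Zd d => (k i)%:~R * pdist m a k) 0.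
Proof.
apply: (@sums_to_odd R _ _ (fun k : Zd d => [ffun j => - k j])).
- by move=> k; apply/ffunP => j; rewrite !ffunE opprK.
- move=> k; rewrite ffunE mulrNz mulNr; congr (- (_ * (_ * _ `^ _))).
  by congr (1 + _); apply: eq_bigr => j _; rewrite ffunE mulrNz sqrrN.
- apply: le_lt_trans (pdist_moment2_lty i); apply: le_esum => k _.
  rewrite lee_fin normrM (gtr0_norm (pdist_gt0 k)).
  by rewrite ler_wpM2r ?(ltW (pdist_gt0 k))// norm_intr_le_sqr.
Qed.

Lemma pdist_moment2 i :
  sums_to (fun k : Zd d => (k i)%:~R ^+ 2 * pdist m a k)
    (series_sum (fun k : Zd d => (k i)%:~R ^+ 2 * pdist m a k)).
Proof.
split => //; apply: le_lt_trans (pdist_moment2_lty i); apply: le_esum => k _.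
by rewrite ger0_norm// mulr_ge0 ?sqr_ge0 ?(ltW (pdist_gt0 k)).
Qed.

(** The relation between m and q makes the exponent -(m+d)/2 (q-1) equal to 1. *)
Lemma pdist_powR (q : R) k : q < 1 -> (m + d%:R) / 2 = (1 - q)^-1 ->
  pdist m a k `^ (q - 1) = (fmd m a)^-1 `^ (q - 1) *
    (1 + \sum_(i < d) ((k i)%:~R ^+ 2 / a i ^+ 2)).
Proof.
move=> q1 mq; rewrite /pdist powRM ?weight_ge0 ?invr_ge0 ?(ltW fmd_gt0)//.
congr (_ * _); rewrite /weight -powRrM mq.
rewrite (_ : _ * _ = 1); last by field; rewrite subr_eq0 gt_eqF.
by rewrite powRr1// ltW// quad_gt0.
Qed.

Lemma pdist_max (q : R) (p' : Zd d -> R) : 0 < q -> q < 1 ->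
  (m + d%:R) / 2 = (1 - q)^-1 -> prob_distr p' ->
  (forall i, sums_to (fun k : Zd d => (k i)%:~R ^+ 2 * p' k)
    (series_sum (fun k : Zd d => (k i)%:~R ^+ 2 * pdist m a k))) ->
  (tsallis q p' <= tsallis q (pdist m a))%E.
Proof.
move=> q0 q1 mq [p'0 p'1] p'u.
have p0 k := ltW (pdist_gt0 k).
pose u i := series_sum (fun k : Zd d => (k i)%:~R ^+ 2 * pdist m a k).
pose c := q * (fmd m a)^-1 `^ (q - 1).
have c0 : 0 <= c by rewrite mulr_ge0 ?powR_ge0// ltW.
(* Used for both [pdist m a] and [p']: the coefficients are affine in the k_i^2, so the pairing sees
   only the mass and the second moments. *)
have lin (p : Zd d -> R) : (forall k, 0 <= p k) -> sums_to p 1 ->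
    (forall i, sums_to (fun k : Zd d => (k i)%:~R ^+ 2 * p k) (u i)) ->
    (\esum_(k in [set: Zd d]) (q * pdist m a k `^ (q - 1) * p k)%:E =
      (c * (1 + \sum_(i < d) (u i / a i ^+ 2)))%:E)%E.
  move=> pp0 /sums_to_ge0 p1 pu; rewrite EFinM.
  rewrite -(@esum_quad a p u)//; last 2 first.
  - exact: p1.
  - by move=> i; apply/sums_to_ge0 => // k; rewrite mulr_ge0 ?sqr_ge0.
  transitivity (\esum_(k in [set: Zd d]) (c%:E *
      ((1 + \sum_(i < d) ((k i)%:~R ^+ 2 / a i ^+ 2)) * p k)%:E))%E.
    by apply: eq_esum => k _; rewrite pdist_powR// -EFinM /c !mulrA.
  rewrite (@ge0_esumZl R {ffun 'I_d -> int})// => k.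
  by rewrite lee_fin mulr_ge0// ltW// quad_gt0.
have [_ p1] := pdist_prob.
have lp := lin _ p0 p1 pdist_moment2.
have lp' := lin _ p'0 p'1 p'u.
have le : (\esum_(k in [set: Zd d]) (p' k `^ q)%:E <=
           \esum_(k in [set: Zd d]) (pdist m a k `^ q)%:E)%E.
  rewrite -(@leeD2rE _ (c * (1 + \sum_(i < d) (u i / a i ^+ 2)))%:E)//.
  (* The common finite value is read as the pairing with p on the left and with [p'] on the right,
     which is the tangent inequality summed over k. *)
  rewrite -{1}lp -lp'.
  have c0' (p : Zd d -> R) k : (forall k, 0 <= p k) ->
      (0 <= (q * pdist m a k `^ (q - 1) * p k)%:E)%E.
    by move=> pp0; rewrite lee_fin mulr_ge0 ?pp0// mulr_ge0 ?powR_ge0// ltW.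
  rewrite -!esumD; try by move=> k _; rewrite ?c0' ?lee_fin ?powR_ge0.
  apply: le_esum => k _; rewrite -!EFinD lee_fin.
  by apply: powR_tangent; rewrite ?q0 ?pdist_gt0.
(* The prefactor 1/(q-1) is negative, so a larger sum of q-th powers means a larger entropy. *)
rewrite /tsallis -[q - 1]opprB invrN EFinN !mulNe leeN2 lee_wpmul2l//.
  by rewrite lee_fin invr_ge0 subr_ge0 ltW.
exact: leeB.
Qed.

End pdist.
End maximality.

Theorem theorem8 (R : realType) (d : nat) (q : R) :
  (1 <= d)%N ->
  d%:R / (d%:R + 2) < q -> q < 1 ->
  let m := 2 / (1 - q) - d%:R in
  (* (a) *)
  (forall a : 'I_d -> R, (forall i, 0 < a i) ->
     let p := pdist m a in
     let u2 := fun i : 'I_d => series_sum (fun k : Zd d => (k i)%:~R ^+ 2 * p k) in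
     [/\ prob_distr p,
         (forall i, sums_to (fun k : Zd d => (k i)%:~R * p k) 0),
         (forall i, sums_to (fun k : Zd d => (k i)%:~R ^+ 2 * p k) (u2 i)) &
         (forall p' : Zd d -> R, prob_distr p' ->
            (forall i, sums_to (fun k : Zd d => (k i)%:~R * p' k) 0) ->
            (forall i, sums_to (fun k : Zd d => (k i)%:~R ^+ 2 * p' k) (u2 i)) ->
            (tsallis q p' <= tsallis q p)%E)]) /\
  (* (b) : limit as min_i a_i -> +oo *)
  (forall eps : R, 0 < eps -> exists M : R, forall a : 'I_d -> R,
     (forall i, M < a i) ->
     `| fmd m a / (\prod_(i < d) a i)
        - pi `^ (d%:R / 2) * Gamma (m / 2) / Gamma ((m + d%:R) / 2) | < eps).
Proof.
move=> d1 qd q1 m.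
have dd : 0 < d%:R + 2 :> R by rewrite ltr_wpDl.
have q0 : 0 < q by rewrite (le_lt_trans _ qd)// divr_ge0// ltW.
have q1' : 0 < 1 - q by rewrite subr_gt0.
have m2 : 2 < m.
  (* The claim reads (d + 2)(1 - q) < 2, which is d < (d + 2) q. *)
  rewrite /m ltrBrDl ltr_pdivlMr//.
  by move: qd; rewrite ltr_pdivrMr//; lra.
have m0 : 0 < m by rewrite (lt_trans _ m2).
have mq : (m + d%:R) / 2 = (1 - q)^-1 by rewrite /m; field; rewrite gt_eqF.
split.
  move=> a a0 /=; split.
  - exact: pdist_prob.
  - by move=> i; exact: pdist_mean.
  - by move=> i; exact: pdist_moment2.
  - by move=> p' p'1 _ p'u; exact: pdist_max.
move=> eps eps0.
pose L := pi `^ (d%:R / 2) * Gamma (m / 2).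
pose G := Gamma ((m + d%:R) / 2).
pose K := d%:R * 2 ^+ d * ((L + G) / G).
have G0 : 0 < G by rewrite Gamma_gt0// mq invr_gt0.
have L0 : 0 <= L by rewrite mulr_ge0 ?powR_ge0// ltW// Gamma_gt0// divr_gt0.
have K0 : 0 <= K.
  by rewrite mulr_ge0 ?mulr_ge0 ?exprn_ge0 ?invr_ge0 ?addr_ge0// ltW.
have K1 : 0 < K + 1 by rewrite ltr_wpDl.
(* The error is at most e K; dividing by K + 1 makes it strictly less than eps even when K = 0, and
   the estimate asks for e <= 1. The threshold for the a_i is then 1/e. *)
pose e := Num.min 1 (eps / (K + 1)).
have e0 : 0 < e by rewrite lt_min ltr01 divr_gt0.
exists e^-1 => a ea.
have [] := @esum_weight_dist R d m e a m0.
- by rewrite e0 ge_min lexx.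
- by move=> i; rewrite ltW.
move=> S S1; rewrite -/L -/G -[e * _ * _]mulrA -/K => h.
rewrite /fmd S1; apply: (le_lt_trans h).
apply: (@le_lt_trans _ _ (eps / (K + 1) * K)).
  by rewrite ler_wpM2r// ge_min lexx orbT.
by rewrite mulrAC ltr_pdivrMr// ltr_pM2l// ltrDl.
Qed.
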